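(* The Mangasarian–Fromovitz constraint qualification holds at every $(w^*,b^*,v^*,u^* )\in\Omega_2$ for problem (PP); that is, there exist no nonzero vectors $\xi\in\mathbb R^m$, $\mu\in\mathbb R^{2m}_+$ (i.e. no $(\xi,\mu)\ne(0,0)$) such that $\mu^\top\mathcal C(v^*,u^* )=0$ and $$0=\Psi(v^* )^\top\xi,\qquad 0=A^\top\xi,$$ $$0=\nabla_v\big(\mu^\top\mathcal C(v,u^* )\big)\big|_{v=v^*}-\nabla_v\big(\xi^\top\Psi(v)w^*\big)\big|_{v=v^*},$$ $$0=\nabla_u\big(\mu^\top\mathcal C(v^*,u)\big)\big|_{u=u^*}+\xi.$$
   Context: Setting. $[K]=\{1,\dots,K\}$. $L,N,N_0,\dots,N_L$ are positive integers, $x_n\in\mathbb R^{N_0}$ ($n\in[N]$) are given data, and $0<\alpha<1$. Variables. $W_\ell\in\mathbb R^{N_\ell\times N_{\ell-1}}$, $b_\ell\in\mathbb R^{N_\ell}$, $v_{n,\ell},u_{n,\ell}\in\mathbb R^{N_\ell}$ for $\ell\in[L]$, $n\in[N]$, with $v_{n,0}:=x_n$. Put $\widetilde N=\sum_{\ell=1}^LN_\ell N_{\ell-1}$, $\overline N=\sum_{\ell=1}^LN_\ell$, $m=N\overline N$. The vectors $w\in\mathbb R^{\widetilde N}$ (stacking the column-wise vectorizations of $W_1,\dots,W_L$), $b\in\mathbb R^{\overline N}$ (stacking $b_1,\dots,b_L$), and $v,u\in\mathbb R^m$ (stacking $v_{n,\ell}$, resp. $u_{n,\ell}$, in the order $(1,1),(2,1),\dots,(N,1),(1,2),\dots,(N,L)$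 of $(n,\ell)$) collect the variables. The linear-in-$w$ map $\Psi(v)w$ and the matrix $A\in\mathbb R^{m\times\overline N}$ are such that $\Psi(v)w+Ab$ has $(n,\ell)$ block $W_\ell v_{n,\ell-1}+b_\ell$; that is, $\Psi(v)$ is block diagonal with blocks $V_{\ell-1}^\top\otimes I_{N_\ell}$, where $V_\ell=(v_{1,\ell},\dots,v_{N,\ell})$, $V_0=(x_1,\dots,x_N)$, and $A$ is block diagonal with blocks $e_N\otimes I_{N_\ell}$ ($e_N$ is the all-ones vector in $\mathbb R^N$). Problem (PP) is the minimization of a certain objective over the feasible set $\Omega_2=\{(w,b,v,u): v-u\ge0,\ v-\alpha u\ge 0,\ u=\Psi(v)w+Ab\}$ (only the feasible set matters here), and $\mathcal C(v,u)=\binom{u-v}{\alpha u-v}\in\mathbb R^{2m}$. *)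

(* Defs.v *)
From HB Require Import structures.
From mathcomp Require Import all_boot all_order all_algebra.
From mathcomp Require Import all_classical all_reals all_analysis.
Set Implicit Arguments.
Unset Strict Implicit.
Unset Printing Implicit Defensive.
Import Order.TTheory GRing.Theory Num.Theory.
Import numFieldNormedType.Exports.
Local Open Scope ring_scope.

(* mxvec and vec_mx are row-major, hence the transpositions below. *)
Definition cvec (R : Type) (p q : nat) (M : 'M[R]_(p, q)) : 'cV[R]_(q * p) :=
  (mxvec M^T)^T.

Definition uncvec (R : Type) (p q : nat) (c : 'cV[R]_(q * p)) : 'M[R]_(p, q) :=
  (vec_mx c^T)^T.

(* Inverse of (i, j) |-> mxvec_index i j; see val_mxvec_index below. *)
Definition mxvec_pair (m n : nat) (k : 'I_(m * n)) : 'I_m * 'I_n :=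
  enum_val (cast_ord (esym (mxvec_cast m n)) k).

Definition kron (R : pzRingType) (m n p q : nat)
    (M : 'M[R]_(m, n)) (P : 'M[R]_(p, q)) : 'M[R]_(m * p, n * q) :=
  \matrix_(i, j) (M (mxvec_pair i).1 (mxvec_pair j).1
                  * P (mxvec_pair i).2 (mxvec_pair j).2).

(* Rectangular counterpart of mxdiag; as there, conform_mx only serves to type
   the diagonal blocks, where both dimensions agree. *)
Definition blockdiag (R : pzRingType) (k : nat) (p_ q_ : 'I_k -> nat)
    (B : forall i : 'I_k, 'M[R]_(p_ i, q_ i)) :
    'M[R]_(\sum_i p_ i, \sum_i q_ i) :=
  \mxblock_(i, j) if i == j then conform_mx 0 (B i) else 0.

Definition dotc (R : pzRingType) (m : nat) (x y : 'cV[R]_m) : R :=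
  (x^T *m y) 0 0.

Definition gradient (R : realType) (m : nat) (f : 'cV[R]_m -> R)
    (x : 'cV[R]_m) : 'cV[R]_m :=
  \col_i 'D_(delta_mx i 0) f x.

(* Layers are numbered from 0: l : 'I_L stands for the (l+1)-st layer, whose
   input and output widths are d l and d l.+1.  Only d 0, ..., d L matter. *)
Notation wdim L d := (\sum_(l < L) d (nat_of_ord l) * d (nat_of_ord l).+1)%N.
Notation bdim L d := (\sum_(l < L) d (nat_of_ord l).+1)%N.
Notation vdim L N d := (\sum_(l < L) N * d (nat_of_ord l).+1)%N.

Lemma vdimE (L N : nat) (d : nat -> nat) : vdim L N d = (N * bdim L d)%N.
Proof. by rewrite big_distrr. Qed.

(* activations x v (k <= L) is V_k = (v_{1,k}, ..., v_{N,k}), with V_0 the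
   data. *)
Definition activations (R : pzRingType) (L N : nat) (d : nat -> nat)
    (x : 'I_N -> 'cV[R]_(d 0%N)) (v : 'cV[R]_(vdim L N d)) (k : nat) :
    (k <= L)%N -> 'M[R]_(d k, N) :=
  match k return (k <= L)%N -> 'M[R]_(d k, N) with
  | 0 => fun _ => \matrix_(i, n) x n i 0
  | k'.+1 => fun lt_k'L => uncvec (submxcol v (Ordinal lt_k'L))
  end.

Definition Psi (R : pzRingType) (L N : nat) (d : nat -> nat)
    (x : 'I_N -> 'cV[R]_(d 0%N)) (v : 'cV[R]_(vdim L N d)) :
    'M[R]_(vdim L N d, wdim L d) :=
  blockdiag (fun l : 'I_L =>
    kron (activations x v (ltnW (ltn_ord l)))^T (1%:M : 'M[R]_(d l.+1))).

Definition Amx (R : pzRingType) (L N : nat) (d : nat -> nat) :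
    'M[R]_(vdim L N d, bdim L d) :=
  blockdiag (fun l : 'I_L =>
    castmx (erefl, mul1n (d l.+1))
      (kron (const_mx 1 : 'cV[R]_N) (1%:M : 'M[R]_(d l.+1)))).

Definition Omega2 (R : realType) (L N : nat) (d : nat -> nat)
    (x : 'I_N -> 'cV[R]_(d 0%N)) (alpha : R)
    (w : 'cV[R]_(wdim L d)) (b : 'cV[R]_(bdim L d))
    (v u : 'cV[R]_(vdim L N d)) : Prop :=
  [/\ v - u \is a mxOver Num.nneg,
      v - alpha *: u \is a mxOver Num.nneg &
      u = Psi x v *m w + Amx R L N d *m b].

Definition Cmap (R : pzRingType) (m : nat) (alpha : R) (v u : 'cV[R]_m) :
    'cV[R]_(m + m) :=
  col_mx (u - v) (alpha *: u - v).

Lemma index_allpairs (T1 T2 : eqType) (s : seq T1) (t : seq T2) x y :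
  x \in s -> y \in t ->
  index (x, y) (allpairs pair s t) = (index x s * size t + index y t)%N.
Proof.
move=> + yt; elim: s => //= a s IH; rewrite inE index_cat.
have [->|ne] /= := eqVneq a x.
  by move=> _; rewrite map_f // index_map // => ? ? [].
move=> xs; rewrite size_map IH // mulSn addnA.
by case: ifP => // /mapP[? _ [e]]; rewrite e eqxx in ne.
Qed.

Lemma val_mxvec_index (m n : nat) (i : 'I_m) (j : 'I_n) :
  mxvec_index i j = (i * n + j)%N :> nat.
Proof.
rewrite /=; set k := enum_rank _.
have -> : k = index (i, j) (enum {: 'I_m * 'I_n}) :> nat.
  by rewrite -{1}(nth_enum_rank (i, j) (i, j)) index_uniq ?enum_uniq // -cardE.
have -> : enum {: 'I_m * 'I_n} = allpairs pair (enum 'I_m) (enum 'I_n).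
  by rewrite enumT unlock.
by rewrite index_allpairs ?mem_enum // -cardE card_ord !index_enum_ord.
Qed.

Section Blocks.
Variable R : comPzRingType.

Lemma mxvec_indexK (m n : nat) (i : 'I_m) (j : 'I_n) :
  mxvec_pair (mxvec_index i j) = (i, j).
Proof. by rewrite /mxvec_pair /mxvec_index cast_ordK enum_rankK. Qed.

Lemma kronE (m n p q : nat) (M : 'M[R]_(m, n)) (P : 'M[R]_(p, q)) i j k l :
  kron M P (mxvec_index i k) (mxvec_index j l) = M i j * P k l.
Proof. by rewrite mxE !mxvec_indexK. Qed.

Lemma cvecE (p q : nat) (M : 'M[R]_(p, q)) i j :
  cvec M (mxvec_index j i) 0 = M i j.
Proof. by rewrite mxE mxvecE mxE. Qed.

Lemma uncvecE (p q : nat) (c : 'cV[R]_(q * p)) i j :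
  uncvec c i j = c (mxvec_index j i) 0.
Proof. by rewrite !mxE. Qed.

Lemma uncvecK (p q : nat) : cancel (@uncvec R p q) (@cvec R p q).
Proof. by move=> c; rewrite /cvec /uncvec trmxK vec_mxK trmxK. Qed.

Lemma kron_cvec (m n p q : nat) (M : 'M[R]_(m, n)) (P : 'M[R]_(p, q))
    (Z : 'M[R]_(q, n)) :
  kron M P *m cvec Z = cvec (P *m Z *m M^T).
Proof.
apply/colP => k; case/mxvec_indexP: k => i j; rewrite cvecE mxE.
rewrite (reindex _ (curry_mxvec_bij _ _)) /=.
transitivity (\sum_(p0 : 'I_n * 'I_q) M i p0.1 * P j p0.2 * Z p0.2 p0.1).
  by apply: eq_bigr => -[k l] _ /=; rewrite kronE cvecE.
rewrite -(pair_bigA _ (fun k l => M i k * P j l * Z l k)) /= mxE.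
apply: eq_bigr => k _; rewrite !mxE mulr_suml.
by apply: eq_bigr => l _; rewrite -mulrA mulrC.
Qed.

Lemma blockdiag_mul (k : nat) (p_ q_ : 'I_k -> nat)
    (B : forall i : 'I_k, 'M[R]_(p_ i, q_ i)) (c : 'cV[R]_(\sum_i q_ i)) i :
  submxcol (blockdiag B *m c) i = B i *m submxcol c i.
Proof.
rewrite -{1}[c]submxcolK mul_mxblock_mxrow mxcolK (bigD1 i) //= eqxx.
rewrite conform_mx_id big1 ?addr0 // => j ne_ji.
by rewrite eq_sym (negbTE ne_ji) mul0mx.
Qed.

Lemma ones_kron (N q : nat) (c : 'cV[R]_q) :
  castmx (erefl, mul1n q) (kron (const_mx 1 : 'cV[R]_N) (1%:M : 'M[R]_q)) *m c
  = cvec (c *m (const_mx 1 : 'rV[R]_N)).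
Proof.
apply/colP => k; case/mxvec_indexP: k => i j.
rewrite cvecE !mxE big_ord1 !mxE mulr1 (bigD1 j) //= big1 ?addr0.
  rewrite castmxE cast_ord_id /=.
  have -> : cast_ord (esym (mul1n q)) j = mxvec_index (ord0 : 'I_1) j.
    by apply: ord_inj; rewrite val_mxvec_index.
  by rewrite kronE !mxE eqxx !mul1r.
move=> j' ne_j'j; rewrite castmxE cast_ord_id /=.
have -> : cast_ord (esym (mul1n q)) j' = mxvec_index (ord0 : 'I_1) j'.
  by apply: ord_inj; rewrite val_mxvec_index.
by rewrite kronE !mxE eq_sym (negbTE ne_j'j) mulr0 mul0r.
Qed.

(* The (n, l) block of Psi(v) w + A b is W_l v_{n,l-1} + b_l. *)
Lemma Psi_Amx_block (L N : nat) (d : nat -> nat) (x : 'I_N -> 'cV[R]_(d 0%N))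
    (v : 'cV[R]_(vdim L N d)) (w : 'cV[R]_(wdim L d)) (b : 'cV[R]_(bdim L d))
    (l : 'I_L) (n : 'I_N) :
  col n (uncvec (submxcol (Psi x v *m w + Amx R L N d *m b) l)) =
  uncvec (submxcol w l) *m col n (activations x v (ltnW (ltn_ord l)))
  + submxcol b l.
Proof.
have -> : submxcol (Psi x v *m w + Amx R L N d *m b) l
    = submxcol (Psi x v *m w) l + submxcol (Amx R L N d *m b) l.
  by apply/matrixP => i j; rewrite !mxE.
transitivity (col n (uncvec (
  cvec (uncvec (submxcol w l) *m activations x v (ltnW (ltn_ord l)))
  + cvec (submxcol b l *m (const_mx 1 : 'rV[R]_N))))).
  congr (col n (uncvec (_ + _))); apply: etrans (blockdiag_mul _ _ _) _.
    rewrite -[in LHS](uncvecK (submxcol w l)).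
    by apply: etrans (kron_cvec _ _ _) _; rewrite trmxK mul1mx.
  exact: ones_kron.
apply/colP => i; rewrite [LHS]mxE uncvecE [LHS]mxE !cvecE !mxE big_ord1.
rewrite [const_mx _ _ _]mxE mulr1 [submxcol b l i _]mxE; congr (_ + _).
by apply: eq_bigr => j _; rewrite [col _ _ _ _]mxE.
Qed.

End Blocks.

(* Main.v *)
Require Import Defs.
From HB Require Import structures.
From mathcomp Require Import all_boot all_order all_algebra.
From mathcomp Require Import all_classical all_reals all_analysis.
From mathcomp Require Import ring.
Set Implicit Arguments.
Unset Strict Implicit.
Unset Printing Implicit Defensive.
Import Order.TTheory GRing.Theory Num.Theory.
Import numFieldNormedType.Exports.
Local Open Scope ring_scope.

(** The feed-forward structure makes the stationarity equations triangular in
    the layers.  Write [mu = (mu1, mu2)].  The [u]-equation says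
    [xi = - (mu1 + alpha mu2)], and the [v]-equation says
    [- (mu1 + mu2) = J^T xi], where [J] is the derivative of
    [v |-> Psi(v) w].  Layer [l] of [Psi(v) w] depends on layer [l - 1] of [v]
    only, so layer [l] of [J^T xi] involves layer [l + 1] of [xi] only
    ([gradient_Psi_eq0]).  Hence, as soon as layer [l + 1] of [xi] vanishes
    (vacuously so for the last layer), [mu1 + mu2 = 0] in layer [l]; since both
    are nonnegative they vanish there, and then so does layer [l] of [xi] by
    the [u]-equation.  Descending induction on the layer ends the proof.

    Every partial derivative that occurs is that of a function which is affine
    along the coordinate line considered: [mu^T C] is affine in [v] and in
    [u], and [xi^T Psi(v) w] is constant along the coordinates of layer [l] of
    [v] when layer [l + 1] of [xi] is zero.  So [gradient_affine] computes all
    of them. *)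

Lemma dotcE (R : pzRingType) (m : nat) (x y : 'cV[R]_m) :
  dotc x y = \sum_k x k 0 * y k 0.
Proof. by rewrite /dotc mxE; apply: eq_bigr => k _; rewrite mxE. Qed.

Lemma eq_dotc (R : pzRingType) (m : nat) (x y z : 'cV[R]_m) :
  (forall k, x k 0 = 0 \/ y k 0 = z k 0) -> dotc x y = dotc x z.
Proof.
move=> xyz; rewrite !dotcE; apply: eq_bigr => k _.
by case: (xyz k) => ->; rewrite ?mul0r.
Qed.

(** Along the [k]-th coordinate line the difference quotient is constantly [c],
    so the limit exists whatever [f] does off that line. *)
Lemma gradient_affine (R : realType) (m : nat) (f : 'cV[R]_m -> R)
    (x : 'cV[R]_m) (k : 'I_m) (c : R) :
  (forall h : R, f (h *: delta_mx k 0 + x) = f x + h * c) ->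
  gradient f x k 0 = c.
Proof.
move=> fx; rewrite mxE /derive; apply: (@lim_near_cst R^o) => //.
near=> h; rewrite /= fx addrC addKr.
suff h0 : h != 0 by rewrite /GRing.scale /= mulKf.
by near: h; exact: nbhs_dnbhs_neq.
Unshelve. all: by end_near. Qed.

Lemma eq_submxcol_entry (R : pzRingType) (n : nat) (p_ : 'I_n -> nat)
    (y z : 'cV[R]_(\sum_i p_ i)) (k : 'I_(\sum_i p_ i)) :
  submxcol y (tagnat.sig1 k) = submxcol z (tagnat.sig1 k) -> y k 0 = z k 0.
Proof. by move/colP/(_ (tagnat.sig2 k)); rewrite !mxE tagnat.sig2K. Qed.

Section Gradients.
Variables (R : realType) (m : nat) (alpha : R) (mu : 'cV[R]_(m + m)).
Implicit Types (v u : 'cV[R]_m) (k : 'I_m).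

Lemma dotc_Cmap v u :
  dotc mu (Cmap alpha v u) =
  \sum_k (mu (lshift m k) 0 * (u k 0 - v k 0)
          + mu (rshift m k) 0 * (alpha * u k 0 - v k 0)).
Proof.
rewrite dotcE big_split_ord /= -big_split /=; apply: eq_bigr => k _.
by rewrite col_mxEu col_mxEd !mxE.
Qed.

Lemma gradient_Cmap_v v u k :
  gradient (fun v' => dotc mu (Cmap alpha v' u)) v k 0 =
  - (mu (lshift m k) 0 + mu (rshift m k) 0).
Proof.
apply: gradient_affine => h; rewrite !dotc_Cmap.
rewrite (bigD1 k) //= [in RHS](bigD1 k) //=.
rewrite (eq_bigr (fun j => mu (lshift m j) 0 * (u j 0 - v j 0)
          + mu (rshift m j) 0 * (alpha * u j 0 - v j 0))); last first.
  by move=> j jk; rewrite !mxE (negbTE jk) /= mulr0 add0r.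
by rewrite !mxE !eqxx /=; ring.
Qed.

Lemma gradient_Cmap_u v u k :
  gradient (fun u' => dotc mu (Cmap alpha v u')) u k 0 =
  mu (lshift m k) 0 + alpha * mu (rshift m k) 0.
Proof.
apply: gradient_affine => h; rewrite !dotc_Cmap.
rewrite (bigD1 k) //= [in RHS](bigD1 k) //=.
rewrite (eq_bigr (fun j => mu (lshift m j) 0 * (u j 0 - v j 0)
          + mu (rshift m j) 0 * (alpha * u j 0 - v j 0))); last first.
  by move=> j jk; rewrite !mxE (negbTE jk) /= mulr0 add0r.
by rewrite !mxE !eqxx /=; ring.
Qed.

End Gradients.

Section FeedForward.
Variables (R : realType) (L N : nat) (d : nat -> nat).
Variables (x : 'I_N -> 'cV[R]_(d 0%N)) (w : 'cV[R]_(wdim L d)).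
Implicit Types (v xi : 'cV[R]_(vdim L N d)).

Lemma activations_eq v v' (l : nat) (lL : (l <= L)%N) :
  (forall i : 'I_L, i.+1 = l -> submxcol v i = submxcol v' i) ->
  activations x v lL = activations x v' lL.
Proof. by case: l lL => [|l] lL //= vv'; rewrite vv'. Qed.

Lemma submxcol_Psi_eq v v' (l : 'I_L) :
  (forall i : 'I_L, i.+1 = l -> submxcol v i = submxcol v' i) ->
  submxcol (Psi x v *m w) l = submxcol (Psi x v' *m w) l.
Proof.
move=> vv'; apply: etrans (blockdiag_mul _ _ _) _.
by apply/esym/(etrans (blockdiag_mul _ _ _)); rewrite (activations_eq _ vv').
Qed.

(** A coordinate of [v] in layer [l] enters [Psi(v) w] through layer [l + 1]
    only, where [xi] kills it. *)
Lemma gradient_Psi_eq0 v xi (k : 'I_(vdim L N d)) :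
  (forall j, tagnat.sig1 j = (tagnat.sig1 k).+1 :> nat -> xi j 0 = 0) ->
  gradient (fun v' => dotc xi (Psi x v' *m w)) v k 0 = 0.
Proof.
move=> xi0; apply: gradient_affine => h; rewrite mulr0 addr0.
apply: eq_dotc => j.
have [/xi0->|jk] := eqVneq (tagnat.sig1 j : nat) (tagnat.sig1 k).+1; first by left.
right; apply: eq_submxcol_entry; apply: submxcol_Psi_eq => i ij.
apply/colP => r; rewrite !mxE.
(* The coordinate [k] lies in another layer than [i]. *)
case: eqVneq => [rk|_]; last by rewrite mulr0 add0r.
by case/eqP: jk; rewrite -rk tagnat.Rank1K ij.
Qed.

End FeedForward.

Theorem lemma4 (R : realType) (L N : nat) (d : nat -> nat)
    (hL : (0 < L)%N) (hN : (0 < N)%N)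
    (hd : forall l : nat, (l <= L)%N -> (0 < d l)%N)
    (x : 'I_N -> 'cV[R]_(d 0%N)) (alpha : R) (halpha : 0 < alpha < 1)
    (w : 'cV[R]_(wdim L d)) (b : 'cV[R]_(bdim L d))
    (v u : 'cV[R]_(vdim L N d)) (hOmega : Omega2 x alpha w b v u) :
  ~ exists (xi : 'cV[R]_(vdim L N d)) (mu : 'cV[R]_(vdim L N d + vdim L N d)),
      ((xi, mu) <> (0, 0)) /\
      mu \is a mxOver Num.nneg /\
      dotc mu (Cmap alpha v u) = 0 /\
      0 = (Psi x v)^T *m xi /\
      0 = (Amx R L N d)^T *m xi /\
      0 = gradient (fun v' => dotc mu (Cmap alpha v' u)) v
          - gradient (fun v' => dotc xi (Psi x v' *m w)) v /\
      0 = gradient (fun u' => dotc mu (Cmap alpha v u')) u + xi.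
Proof.
case=> xi [mu [neq0 [/mxOverP mu_ge0 [_ [_ [_ [grad_v grad_u]]]]]]].
have mu0 i : 0 <= mu i 0 by have := mu_ge0 i 0; rewrite nnegrE.
have xiE k : xi k 0 = - (mu (lshift _ k) 0 + alpha * mu (rshift _ k) 0).
  move/colP/(_ k): grad_u; rewrite [in RHS]mxE gradient_Cmap_u mxE.
  by move/esym/eqP; rewrite addrC addr_eq0 => /eqP.
have vanish n (k : 'I_(vdim L N d)) : (L - tagnat.sig1 k <= n)%N ->
    [/\ mu (lshift _ k) 0 = 0, mu (rshift _ k) 0 = 0 & xi k 0 = 0].
  (* [n] bounds the distance from the layer of [k] to the output; it is at
     least 1, so the base case is void. *)
  elim: n k => [|n IHn] k kn.
    by move: kn; rewrite leqn0 subn_eq0 leqNgt ltn_ord.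
  have xi_next j : tagnat.sig1 j = (tagnat.sig1 k).+1 :> nat -> xi j 0 = 0.
    move=> jk; have [] // := IHn j _.
    by rewrite jk subnS -subn1 leq_subLR add1n.
  move/colP/(_ k): grad_v; rewrite [in RHS]mxE gradient_Cmap_v mxE.
  rewrite [in RHS]mxE gradient_Psi_eq0 // subr0 => /esym/eqP.
  rewrite oppr_eq0 paddr_eq0 // => /andP[/eqP mu1 /eqP mu2].
  by rewrite xiE mu1 mu2 mulr0 addr0 oppr0.
apply: neq0; congr (_, _); apply/colP => k; rewrite [RHS]mxE.
  by have [] := vanish _ k (leqnn _).
by case: (split_ordP k) => j ->; have [] := vanish _ j (leqnn _).
Qed.
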